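(* For each integer $n \geq 1$ let $d_n = \mathrm{lnzd}(n!)$, and let $F = 0.d_1d_2d_3\dots d_n\dots = \sum_{n=1}^{\infty} d_n 10^{-n}$ be the real number whose $n$-th decimal digit after the decimal point is $d_n$. Then $F$ is irrational.
   Context: For a positive integer $A$, $\mathrm{lnzd}(A)$ denotes the last nonzero digit of $A$ in base $10$; that is, $\mathrm{lnzd}(A) \in \{1,\dots,9\}$ is the remainder of $A/10^i$ modulo $10$, where $10^i$ is the largest power of $10$ dividing $A$. *)

(* Defs.v *)
From mathcomp Require Import all_boot all_order all_algebra.
From mathcomp Require Import all_classical all_reals all_analysis.
Import Order.TTheory GRing.Theory Num.Theory.
Import numFieldNormedType.Exports.

Set Implicit Arguments.
Unset Strict Implicit.
Unset Printing Implicit Defensive.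

(* For A > 0 the bound i < A.+1 is harmless: 10 ^ i %| A forces i < 10 ^ i <= A
   (see pow10_val_max). *)
Definition pow10_val (A : nat) : nat := (\max_(i < A.+1 | 10 ^ i %| A) i)%N.

(* Only meaningful for A > 0; lnzd 0 = 0. *)
Definition lnzd (A : nat) : nat := ((A %/ 10 ^ pow10_val A) %% 10)%N.

Lemma pow10_val_dvd (A : nat) : (10 ^ pow10_val A %| A)%N.
Proof.
rewrite /pow10_val; elim/big_ind: _ => [|x y hx hy|//]; first by rewrite expn0 dvd1n.
by rewrite /maxn; case: ifP.
Qed.

Lemma pow10_val_max (A i : nat) :
  (0 < A)%N -> (10 ^ i %| A)%N -> (i <= pow10_val A)%N.
Proof.
move=> A0 iA.
have iltA : (i < A.+1)%N.
  by rewrite ltnS (leq_trans (ltnW (ltn_expl i (isT : (1 < 10)%N))))// dvdn_leq.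
exact: (@leq_bigmax_cond _ (fun j : 'I_A.+1 => 10 ^ j %| A)%N
          (fun j => j : nat) (Ordinal iltA)).
Qed.

Lemma lnzd_gt0 (A : nat) : (0 < A)%N -> (0 < lnzd A)%N.
Proof.
move=> A0; rewrite lt0n; apply/negP => /eqP /eqP dvd10.
have : (10 ^ (pow10_val A).+1 %| A)%N.
  by rewrite expnS -[X in (_ %| X)%N](divnK (pow10_val_dvd A)) dvdn_mul.
by move/(pow10_val_max A0); rewrite ltnn.
Qed.

Local Open Scope ring_scope.

Definition lnzd_fact_number (R : realType) : R :=
  limn (fun N => \sum_(1 <= n < N) (lnzd n`!)%:R / 10 ^+ n : R).

Lemma is_cvg_lnzd_fact_number (R : realType) :
  cvgn (fun N => \sum_(1 <= n < N) (lnzd n`!)%:R / 10 ^+ n : R).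
Proof.
rewrite (is_cvg_series_restrict 1 (fun n => (lnzd n`!)%:R / 10 ^+ n : R)).
apply: (@series_le_cvg _ _ (geometric 9 (10^-1))) => [n|n|n|].
- by rewrite divr_ge0// exprn_ge0.
- by rewrite /= mulr_ge0// exprn_ge0// invr_ge0.
- rewrite /= exprVn ler_wpM2r ?invr_ge0 ?exprn_ge0//.
  by rewrite (ler_nat _ _ 9) -ltnS ltn_mod.
- by apply: is_cvg_geometric_series; rewrite ger0_norm ?invr_ge0// invf_lt1// ltr1n.
Qed.

(* Main.v *)
(** If F is rational with denominator b, the tails T_N of its expansion satisfy
    b T_N \in {1, ..., b}, so two of them coincide and the digits d_n are
    eventually periodic, of period p say. On the other hand v_5(n!) <= v_2(n!),
    hence d_n = chi(n!) modulo 5 for a completely multiplicative chi with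
    nonzero values. Then chi(n + p) = chi(n) for all large n; taking n = p t
    and cancelling chi(p) gives chi(t + 1) = chi(t) for all large t, which fails
    at t = 5 N + 1. *)

Require Import Defs.
From mathcomp Require Import all_boot all_order all_algebra.
From mathcomp Require Import all_classical all_reals all_analysis.
From mathcomp Require Import ring lra zify.
Import Order.TTheory GRing.Theory Num.Theory.
Import numFieldNormedType.Exports.

Set Implicit Arguments.
Unset Strict Implicit.
Unset Printing Implicit Defensive.

Local Open Scope ring_scope.

Section PositiveDigits.

Variables (R : realType) (d : nat -> nat).
Hypotheses (d_gt0 : forall n, (0 < d n)%N) (d_le9 : forall n, (d n <= 9)%N).

Let S N : R := \sum_(1 <= n < N) (d n)%:R / 10 ^+ n.
Hypothesis S_cvg : cvgn S.

Let term_gt0 n : 0 < (d n)%:R / 10 ^+ n :> R.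
Proof. by rewrite divr_gt0 ?ltr0n// exprn_gt0. Qed.

Let SS N : S N.+2 = S N.+1 + (d N.+1)%:R / 10 ^+ N.+1.
Proof. by rewrite /S big_nat_recr. Qed.

Let S_ndecr : {homo S : m n / (m <= n)%N >-> m <= n}.
Proof.
apply/nondecreasing_seqP => -[|n]; first by rewrite /S !big_geq.
by rewrite SS lerDl ltW.
Qed.

(** All digits equal to 9 is the extreme case, where [9 / 10 ^ j = 1 / 10 ^ (j - 1) - 1 / 10 ^ j]
    telescopes. *)
Let S_upper N k : S (N + k).+1 <= S N.+1 + (10 ^+ N)^-1 - (10 ^+ (N + k))^-1.
Proof.
elim: k => [|k IH]; first by rewrite addn0 addrK.
rewrite addnS SS; apply: le_trans (lerD IH (lexx _)) _.
rewrite -addrA lerD2l exprS invfM.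
have x_gt0 : 0 < (10 ^+ (N + k))^-1 :> R by rewrite invr_gt0 exprn_gt0.
have : (d (N + k).+1)%:R <= 9 :> R by rewrite (ler_nat _ _ 9).
by nra.
Qed.

(** The number 0.d_(N+1) d_(N+2)...; the index is [N.+1] because [S] excludes its upper bound. *)
Definition decimal_tail N : R := 10 ^+ N * (limn S - S N.+1).

Lemma decimal_tail0 : decimal_tail 0 = limn S.
Proof. by rewrite /decimal_tail /S big_geq// mul1r subr0. Qed.

Lemma decimal_tailS N :
  decimal_tail N.+1 = 10 * decimal_tail N - (d N.+1)%:R.
Proof.
rewrite /decimal_tail SS opprD addrA mulrBr mulrCA divff ?expf_neq0// mulr1.
by rewrite exprS mulrA.
Qed.

(** The digit [d N.+1] alone already contributes a positive amount. *)
Lemma decimal_tail_gt0 N : 0 < decimal_tail N.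
Proof.
rewrite mulr_gt0 ?exprn_gt0// subr_gt0.
by apply: lt_le_trans (nondecreasing_cvgn_le S_ndecr S_cvg N.+2); rewrite SS ltrDl.
Qed.

Lemma decimal_tail_le1 N : decimal_tail N <= 1.
Proof.
rewrite -ler_pdivlMl ?exprn_gt0// mulr1 lerBlDl.
apply: limr_le => //; exists N.+1 => // n /= lt_Nn.
rewrite -(ltn_predK lt_Nn) -[n.-1](@subnKC N) -1?ltnS ?(ltn_predK lt_Nn)//.
by apply: le_trans (S_upper _ _) _; rewrite gerDl oppr_le0 invr_ge0 exprn_ge0.
Qed.

(* Tails lie in the half-open interval (0, 1], so a tail determines the digits
   it is made of. *)
Lemma decimal_tail_inj m n : decimal_tail m = decimal_tail n ->
  d m.+1 = d n.+1 /\ decimal_tail m.+1 = decimal_tail n.+1.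
Proof.
move=> eq_mn.
suff eq_d : d m.+1 = d n.+1 by rewrite !decimal_tailS eq_mn eq_d.
have := decimal_tailS m; have := decimal_tailS n; rewrite eq_mn.
have := decimal_tail_gt0 m.+1; have := decimal_tail_le1 m.+1.
have := decimal_tail_gt0 n.+1; have := decimal_tail_le1 n.+1.
move=> ? ? ? ? ? ?.
(* Both digits are ten times the common tail minus a number in (0, 1], so they differ by less than
   1. *)
have le_digit a b : a%:R < b%:R + 1 :> R -> (a <= b)%N.
  by rewrite natr1 ltr_nat ltnS.
by apply/eqP; rewrite eqn_leq !le_digit//; lra.
Qed.

Lemma rational_eventually_periodic : rational (limn S) ->
  exists N p, (0 < p)%N /\ forall n, (N <= n)%N -> d (n + p) = d n.
Proof.
case=> q _ qE; pose b := `|denq q|%N.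
have bE : b%:R = (denq q)%:~R :> R by rewrite pmulrn gez0_abs.
have b_gt0 : 0 < b%:R :> R by rewrite bE ltr0z.
(* The recursion for tails has integer coefficients, and [b] clears the denominator of the initial
   tail. *)
have tail_int N : exists z : int, z%:~R = b%:R * decimal_tail N.
  elim: N => [|N [z zE]].
    by exists (numq q); rewrite decimal_tail0 -qE /ratr bE mulrC divfK ?intr_eq0.
  exists (10 * z - b%:Z * (d N.+1)%:Z).
  by rewrite decimal_tailS rmorphB !rmorphM /= zE -!pmulrn; ring.
have tail_nat N : exists i : 'I_b.+1, i%:R = b%:R * decimal_tail N.
  have [z zE] := tail_int N.
  have z_ge0 : 0 <= z.
    by rewrite -(ler0z R) zE mulr_ge0 ?ltW ?decimal_tail_gt0.
  have absz_lt : (`|z| < b.+1)%N.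
    rewrite ltnS -(ler_nat R) [leLHS]pmulrn gez0_abs// zE.
    by rewrite ler_piMr ?decimal_tail_le1 ?ltW.
  by exists (Ordinal absz_lt); rewrite /= pmulrn gez0_abs.
have [i iE] := choice tail_nat.
have [m [n [lt_mn eq_mn]]] :
    exists m n, (m < n)%N /\ decimal_tail m = decimal_tail n.
  (* Pigeonhole: [b.+2] indices for only [b.+1] values. *)
  have /injectivePn[m [n neq_mn eq_mn]] :
      ~~ injectiveb (fun k : 'I_b.+2 => i k).
    by apply/negP => /injectiveP/leq_card; rewrite !card_ord ltnn.
  have eq_tail : decimal_tail m = decimal_tail n.
    by apply: (mulfI (lt0r_neq0 b_gt0)); rewrite -!iE eq_mn.
  have [lt_mn|lt_nm|eq_val] := ltngtP m n.
  - by exists m, n.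
  - by exists n, m.
  - by move: neq_mn; rewrite -val_eqE /= eq_val eqxx.
have eq_shift k : decimal_tail (m + k) = decimal_tail (n + k).
  by elim: k => [|k IH]; rewrite ?addn0// !addnS; apply: (decimal_tail_inj IH).2.
exists m.+1, (n - m)%N; split=> [|k lt_mk]; first by rewrite subn_gt0.
have [+ _] := decimal_tail_inj (eq_shift (k - m.+1)%N).
have -> : ((m + (k - m.+1)).+1 = k)%N by lia.
by have -> : ((n + (k - m.+1)).+1 = k + (n - m))%N by lia.
Qed.

End PositiveDigits.

(* The completely multiplicative extension to multiples of 5 of reduction
   modulo 5 for which 10 is sent to 1: since 5 * 2 = 10, the value at 5 must be
   the inverse 3 of 2. *)
Definition chi (A : nat) : 'F_5 := (A %/ 5 ^ logn 5 A)%:R * 3 ^+ logn 5 A.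

Lemma chiM A B : (0 < A)%N -> (0 < B)%N -> chi (A * B) = chi A * chi B.
Proof.
move=> A_gt0 B_gt0; rewrite /chi lognM// exprD mulrACA -natrM; congr (_%:R * _).
have dvdA := pfactor_dvdnn 5 A; have dvdB := pfactor_dvdnn 5 B.
by rewrite expnD divnMA muln_divA// divn_mulAC.
Qed.

Lemma chi_coprime5 A : ~~ (5 %| A)%N -> chi A = A%:R.
Proof. by move=> ndvd; rewrite /chi lognE (negPf ndvd) !andbF divn1 mulr1. Qed.

(** The cofactor of the 5-part is prime to 5, and 3 is a unit modulo 5. This is what allows
    cancellation later. *)
Lemma chi_neq0 A : (0 < A)%N -> chi A != 0.
Proof.
move=> A_gt0; rewrite mulf_neq0 ?expf_neq0//.
have [q /= ndvd AE] := pfactor_coprime (isT : prime 5) A_gt0.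
rewrite [X in (X %/ _)%N]AE mulnK ?expn_gt0//.
by rewrite -(dvdn_pcharf (pchar_Fp (isT : prime 5))) -prime_coprime.
Qed.

Lemma chi_exp10 v : chi (10 ^ v) = 1.
Proof.
elim: v => [|v IH]; first exact: chi_coprime5.
by rewrite expnS chiM ?expn_gt0// IH mulr1; apply/eqP; vm_compute.
Qed.

(** The exponent of 10 in [A] is then its exponent of 5, so the cofactor is prime to 5; [chi]
    ignores powers of 10, and reduction modulo 10 preserves residues modulo 5. *)
Lemma lnzd_mod5 A : (0 < A)%N -> (logn 5 A <= logn 2 A)%N ->
  (lnzd A)%:R = chi A.
Proof.
move=> A_gt0 le52.
have dvdA : (10 ^ logn 5 A %| A)%N.
  rewrite (expnMn 2 5) Gauss_dvd ?coprimeXl ?coprimeXr//.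
  by rewrite !pfactor_dvdn// le52 leqnn.
have valE : pow10_val A = logn 5 A.
  apply/eqP; rewrite eqn_leq pow10_val_max// andbT -pfactor_dvdn//.
  by apply: dvdn_trans (pow10_val_dvd A); rewrite (expnMn 2 5) dvdn_mull.
rewrite /lnzd valE; set B := (A %/ _)%N.
have AE : A = (B * 10 ^ logn 5 A)%N by rewrite divnK.
have B_gt0 : (0 < B)%N by move: A_gt0; rewrite AE muln_gt0 => /andP[].
have ndvdB : ~~ (5 %| B)%N.
  apply/negP => dvdB; suff: (logn 5 A < logn 5 A)%N by rewrite ltnn.
  rewrite -pfactor_dvdn//.
  rewrite [X in (_ %| X)%N]AE expnS dvdn_mul//.
  by rewrite (expnMn 2 5) dvdn_mull.
rewrite AE chiM ?expn_gt0// chi_exp10 mulr1 chi_coprime5//.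
by rewrite -(Fp_nat_mod (isT : prime 5)) modn_dvdm// Fp_nat_mod.
Qed.

Lemma lnzd_fact_mod5 n : (lnzd n`!)%:R = chi n`!.
Proof.
apply: lnzd_mod5; first exact: fact_gt0.
(* Legendre's formula, compared term by term: [n %/ 5 ^ k <= n %/ 2 ^ k]. *)
rewrite !logn_fact//; apply: leq_sum => k _.
by case: k => [|k]; rewrite leq_div2l ?expn_gt0 ?leq_exp2r.
Qed.

Lemma lnzd_fact_not_eventually_periodic N p : (0 < p)%N ->
  ~ (forall n, (N <= n)%N -> lnzd (n + p)`! = lnzd n`!).
Proof.
move=> p_gt0 per.
have chi_fact n : (N <= n)%N -> chi (n + p)`! = chi n`!.
  by move=> le_Nn; rewrite -!lnzd_fact_mod5 per.
(* Divide the relation for [n.+1] factorial by the one for [n] factorial. *)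
have chi_per n : (N <= n)%N -> chi (n.+1 + p) = chi n.+1.
  move=> le_Nn; have := chi_fact n.+1 (leqW le_Nn).
  rewrite addSn !factS !chiM ?fact_gt0// chi_fact//.
  exact/mulIf/chi_neq0/fact_gt0.
have chi_succ t : (N < t)%N -> chi t.+1 = chi t.
  move=> lt_Nt; have t_gt0 : (0 < t)%N by exact: leq_ltn_trans lt_Nt.
  apply: (mulIf (chi_neq0 p_gt0)); rewrite -!chiM//.
  have tp_gt0 : (N < t * p)%N by apply: leq_trans lt_Nt _; rewrite leq_pmulr.
  by rewrite mulSn addnC -(ltn_predK tp_gt0) chi_per -1?ltnS (ltn_predK tp_gt0).
have five0 : 5%:R = 0 :> 'F_5 by exact: pchar_Fp_0.
(* [5 * N + 1] exceeds [N], and it and its successor are prime to 5, so the classes 1 and 2 modulo 5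
   would agree. *)
have := chi_succ (5 * N + 1)%N ltac:(lia); rewrite !chi_coprime5; try lia.
by rewrite -natr1 natrD natrM five0 mul0r => /eqP; vm_compute.
Qed.

Theorem theorem1 (R : realType) : irrational (lnzd_fact_number R).
Proof.
have d_gt0 n : (0 < lnzd n`!)%N by apply/lnzd_gt0/fact_gt0.
have d_le9 n : (lnzd n`! <= 9)%N by rewrite -ltnS ltn_mod.
case/(rational_eventually_periodic d_gt0 d_le9 (@is_cvg_lnzd_fact_number R)).
by move=> N [p [p_gt0 /lnzd_fact_not_eventually_periodic]]; apply.
Qed.
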